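(* Let $\pi$ be a non-empty set of primes, let $G$ be a $\pi$-torsion-free nilpotent group and let $\widehat{G}^\pi$ be its $\pi$-completion. Then the groups $G$ and $\widehat{G}^\pi$ are geometrically equivalent if and only if, for every $\pi$-number $m$, the group $G$ is geometrically equivalent to its subgroup $G^m$.
   Context: A $\pi$-number is an integer that is a product of powers of primes from $\pi$. A group $G$ is $\pi$-torsion-free if for every $\pi$-number $n$ the equation $x^n=1$ has only the trivial solution in $G$; it is $\pi$-divisible if for every $\pi$-number $n$ and every $a\in G$ the equation $x^n=a$ has a solution in $G$; it is $\pi$-complete if it is both $\pi$-divisible and $\pi$-torsion-free. The $\pi$-completion $\widehat{G}^\pi$ of a $\pi$-torsion-free nilpotent group $G$ is the minimal $\pi$-complete nilpotent group containing $G$. It exists, is unique up to isomorphism, and is characterized as a $\pi$-complete nilpotent group containing $G$ in which every element $g$ satisfies $g^m\in G$ for some $\pi$-number $m$. It is regarded as an abstract group (only the usual group operations). For a group $G$ and an integer $m$, $G^m$ denotes the subgroup of $G$ generated by all $m$-th powers $g^m$, $g\in G$. Geometric equivalence: for a free group $F=F(X)$ on a finite set $X$, a group $G$ and a subset $T\subseteq F$, put $T'_G=\{\varphi\in\mathrm{Hom}(F,G) : T\subseteq \mathrm{Ker}\,\varphi\}$ and $T''_G=\bigcap_{\varphi\in T'_G}\mathrm{Ker}\,\varphi$. Two groups $G_1,G_2$ are geometrically equivalent if $T''_{G_1}=T''_{G_2}$ for every free group $F$ of finite rank and every subset $T\subseteq F$. *)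

(* Defs.v *)
From HB Require Import structures.
From mathcomp Require Import all_boot.
From mathcomp Require Import boolp classical_sets.

Set Implicit Arguments.
Unset Strict Implicit.
Unset Printing Implicit Defensive.

Local Open Scope classical_set_scope.
Local Open Scope group_scope.

(* Groups are possibly infinite: [groupType], not [finGroupType]. *)

Notation hom := UMagmaMorphism.type.

Section Subgroups.

Variable G : groupType.

Record subg_of (S : groupClosed G) : Type :=
  Subg { subg_val : G; subg_valP : subg_val \in S }.

HB.instance Definition _ (S : groupClosed G) :=
  [isSub of subg_of S for @subg_val S].
HB.instance Definition _ (S : groupClosed G) := [Choice of subg_of S by <:].

Lemma groupClosed_closed (S : groupClosed G) :
  group_closed (fun x : G => x \in S).
Proof. by split; [exact: gpred1 | move=> x y; exact: gpredF]. Qed.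

HB.instance Definition _ (S : groupClosed G) :=
  SubChoice_isSubGroup.Build G (fun x : G => x \in S) (subg_of S)
    (groupClosed_closed S).

Definition gen (A : set G) : {pred G} :=
  fun x => `[< forall S : groupClosed G, (forall a, A a -> a \in S) -> x \in S >].

Lemma gen_mul A : mulg_closed (gen A).
Proof.
move=> x y /asboolP genx /asboolP geny; apply/asboolP => S AS.
by apply: gpredM; [exact: genx | exact: geny].
Qed.

Lemma gen_one A : 1 \in gen A.
Proof. by apply/asboolP => S _; exact: gpred1. Qed.

Lemma gen_inv A : invg_closed (gen A).
Proof.
by move=> x /asboolP genx; apply/asboolP => S AS; apply/gpredVr/genx.
Qed.

HB.instance Definition _ A := isMulClosed.Build G (gen A) (@gen_mul A).
HB.instance Definition _ A := isMul1Closed.Build G (gen A) (gen_one A).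
HB.instance Definition _ A := isInvClosed.Build G (gen A) (@gen_inv A).

Definition power_subgroup (m : nat) : groupClosed G :=
  gen [set x ^+ m | x in [set: G]].

Fixpoint lower_central (n : nat) : {pred G} :=
  if n is k.+1 then
    gen [set z | exists x y, x \in lower_central k /\ z = [~ x, y]]
  else predT.

Definition nilpotent_group : Prop :=
  exists c, forall x, x \in lower_central c -> x = 1.

End Subgroups.

(* For a set [pi] of primes, [pi.-nat n] says that [n] is a pi-number. *)

Definition pi_torsion_free (pi : nat_pred) (G : groupType) : Prop :=
  forall n : nat, pi.-nat n -> forall x : G, x ^+ n = 1 -> x = 1.

Definition pi_divisible (pi : nat_pred) (G : groupType) : Prop :=
  forall n : nat, pi.-nat n -> forall a : G, exists x : G, x ^+ n = a.

Definition pi_complete (pi : nat_pred) (G : groupType) : Prop :=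
  pi_divisible pi G /\ pi_torsion_free pi G.

(* Subgroups of nilpotent groups are nilpotent, so in the minimality clause
   nilpotency of [S] need not be required. *)
Definition is_pi_completion (pi : nat_pred) (G Ghat : groupType)
    (iota : hom G Ghat) : Prop :=
  [/\ injective iota, nilpotent_group Ghat, pi_complete pi Ghat
    & forall S : groupClosed Ghat, (forall g, iota g \in S) ->
        pi_complete pi (subg_of S) -> forall x, x \in S].

Definition free_on (X : Type) (F : groupType) (x : X -> F) : Prop :=
  forall (H : groupType) (f : X -> H), exists phi : hom F H,
    phi \o x =1 f /\ forall psi : hom F H, psi \o x =1 f -> psi =1 phi.

Section GeometricEquivalence.

Variables F G : groupType.

Definition Ker (phi : hom F G) : set F := [set w | phi w = 1].

Definition solutions (T : set F) : set (hom F G) :=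
  [set phi | T `<=` Ker phi].

Definition gclosure (T : set F) : set F :=
  \bigcap_(phi in solutions T) Ker phi.

End GeometricEquivalence.

Definition geom_equiv (G1 G2 : groupType) : Prop :=
  forall (X : finType) (F : groupType) (x : X -> F), free_on x ->
    forall T : set F, gclosure G1 T = gclosure G2 T.

(* Free groups exist, so the quantification in [geom_equiv] is not vacuous:
   reduced words, where the letter [(x, true)] is the inverse of [(x, false)]. *)
Section FreeGroup.

Variable X : choiceType.

Local Notation letter := (X * bool)%type.

Definition linv (a : letter) : letter := (a.1, ~~ a.2).

Lemma linvK : involutive linv.
Proof. by case=> x b; rewrite /linv /= negbK. Qed.

Definition reduced (w : seq letter) := sorted (fun a b => b != linv a) w.

Definition push (a : letter) (w : seq letter) : seq letter :=
  if w is b :: w' then if b == linv a then w' else a :: w else [:: a].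

Definition wmul (u v : seq letter) := foldr push v u.
Definition winv (u : seq letter) := rev (map linv u).

Lemma push_reduced a w : reduced w -> reduced (push a w).
Proof.
case: w => [//|b w] /=; case: ifPn => [_|ba bw]; first exact: path_sorted.
by rewrite /= ba.
Qed.

Lemma pushK a w : reduced w -> push a (push (linv a) w) = w.
Proof.
case: w => [|b w] /=; first by rewrite eqxx.
rewrite linvK; case: (eqVneq b a) => [->|_]; last by rewrite /= eqxx.
by case: w => [//|c w] /= /andP[/negbTE->].
Qed.

Lemma wmul_reduced u v : reduced v -> reduced (wmul u v).
Proof. by move=> rv; elim: u => //= a u; exact: push_reduced. Qed.

Lemma wmul_push a u v : reduced v -> wmul (push a u) v = push a (wmul u v).
Proof.
move=> rv; case: u => [//|b u] /=; case: ifP => [/eqP->|//].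
by rewrite pushK// wmul_reduced.
Qed.

Lemma wmulA u v w : reduced w -> wmul u (wmul v w) = wmul (wmul u v) w.
Proof. by move=> rw; elim: u => //= a u ->; rewrite wmul_push. Qed.

Lemma wmulw0 u : reduced u -> wmul u [::] = u.
Proof.
elim: u => //= a u IH ru; rewrite (IH (path_sorted ru)).
by case: u ru {IH} => //= b u /andP[/negbTE->].
Qed.

Lemma winv_reduced u : reduced u -> reduced (winv u).
Proof.
rewrite /reduced /winv rev_sorted sorted_map.
apply: sub_sorted => a b /= ba.
by rewrite linvK eq_sym.
Qed.

Lemma wmul_cat u v w : wmul (u ++ v) w = wmul u (wmul v w).
Proof. exact: foldr_cat. Qed.

Lemma winvl u v : reduced v -> wmul (winv u) (wmul u v) = v.
Proof.
move=> rv; elim: u => //= a u IH.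
rewrite /winv /= rev_cons -cats1 wmul_cat /=.
by rewrite -{2}[a]linvK pushK ?wmul_reduced.
Qed.

Lemma winvK : involutive winv.
Proof. by move=> u; rewrite /winv map_rev revK mapK//; exact: linvK. Qed.

Record free_group : Type := FreeWord { word :> seq letter; wordP : reduced word }.
HB.instance Definition _ := [isSub of free_group for word].
HB.instance Definition _ := [Choice of free_group by <:].

Definition fg_one : free_group := FreeWord (word := [::]) isT.
Definition fg_inv (u : free_group) : free_group :=
  FreeWord (winv_reduced (valP u)).
Definition fg_mul (u v : free_group) : free_group :=
  FreeWord (wmul_reduced (val u) (valP v)).

Lemma fg_mulA : associative fg_mul.
Proof. by move=> u v w; apply/val_inj/wmulA/(valP w). Qed.
Lemma fg_mul1 : left_id fg_one fg_mul.
Proof. by move=> u; apply/val_inj. Qed.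
Lemma fg_mulr1 : right_id fg_one fg_mul.
Proof. by move=> u; apply/val_inj/wmulw0/(valP u). Qed.
Lemma fg_mulV : left_inverse fg_one fg_inv fg_mul.
Proof.
by move=> u; apply/val_inj; rewrite /= -{2}(wmulw0 (valP u)) winvl.
Qed.
Lemma fg_mulrV : right_inverse fg_one fg_inv fg_mul.
Proof.
move=> u; rewrite -[X in fg_mul X](_ : fg_inv (fg_inv u) = u) ?fg_mulV//.
by apply/val_inj/winvK.
Qed.

HB.instance Definition _ :=
  isGroup.Build free_group fg_mulA fg_mul1 fg_mulr1 fg_mulV fg_mulrV.

Definition fg_gen (x : X) : free_group := FreeWord (word := [:: (x, false)]) isT.

Section Lift.

Variables (H : groupType) (f : X -> H).

Definition leval (a : letter) : H := if a.2 then (f a.1)^-1 else f a.1.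
Definition weval (w : seq letter) : H := foldr (fun a h => leval a * h) 1 w.

Lemma leval_inv a : leval (linv a) = (leval a)^-1.
Proof. by case: a => x [] //=; rewrite /leval /= invgK. Qed.

Lemma weval_push a w : weval (push a w) = leval a * weval w.
Proof.
case: w => [//|b w] /=; case: ifP => [/eqP->|//].
by rewrite leval_inv mulgA mulgV mul1g.
Qed.

Lemma weval_mul u v : weval (wmul u v) = weval u * weval v.
Proof.
elim: u => [|a u IH] /=; first by rewrite mul1g.
by rewrite weval_push IH mulgA.
Qed.

Definition fg_lift (u : free_group) : H := weval (val u).

Lemma fg_lift_morphism : monoid_morphism fg_lift.
Proof. by split=> // u v; exact: weval_mul. Qed.

HB.instance Definition _ :=
  isUMagmaMorphism.Build free_group H fg_lift fg_lift_morphism.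

End Lift.

Lemma free_group_free : free_on fg_gen.
Proof.
move=> H f; exists (fg_lift f); split=> [x | psi psif]; first exact: mulg1.
have psiV (u : free_group) : psi u^-1 = (psi u)^-1.
  by apply: (mulIg (psi u)); rewrite -gmulfM !mulVg gmulf1.
case; elim=> [|a w IH] rw.
  by rewrite -[RHS](@gmulf1 _ _ psi); congr (psi _); exact/val_inj.
pose l := FreeWord (word := [:: a]) isT.
pose w' := FreeWord (path_sorted rw : reduced w).
have -> : FreeWord rw = l * w'.
  apply/val_inj; rewrite /= /wmul /=; case: w rw {IH w'} => //= b w.
  by move=> /andP[/negbTE->].
rewrite !gmulfM IH; congr (_ * _).
rewrite /= /fg_lift /= mulg1 /leval /l; move: a {rw w' l} => [x []] /=.
  by rewrite -psif /= -psiV; congr (psi _); exact/val_inj.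
by rewrite -psif /=; congr (psi _); exact/val_inj.
Qed.

End FreeGroup.

(* Main.v *)
From HB Require Import structures.
Require Import Defs.
From mathcomp Require Import all_boot.
From mathcomp Require Import boolp classical_sets.

Set Implicit Arguments.
Unset Strict Implicit.
Unset Printing Implicit Defensive.

Local Open Scope group_scope.

(** Write [e : F -> F] for the endomorphism raising each free generator to its
    [m]-th power.  If [G] and [Ghat] are equivalent and [phi : F -> G] kills
    [T], choose [m]-th roots in [Ghat] of the [phi (x i)]; they define
    [theta : F -> Ghat] with [theta (e v) = phi v].  Any [chi : F -> G] that
    kills the kernel of [theta] gives [chi \o e], which kills [T] and lands in
    [G^m].

    Conversely let [phi : F -> Ghat] kill [T].  Some pi-number [m] has
    [phi (x i) ^+ m] in [G] for all [i], so [phi \o e] factors through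
    [alpha : F -> G].  If [G] has class [c], the elements of [G^(m^c)] are
    [m]-th powers in [G]; hence for [chi : F -> G^(m^c)] killing the kernel of
    [alpha] there is [phi' : F -> G] with [phi' (x i) ^+ m = chi (x i)].  The
    elements having a pi-power in a given subgroup of a nilpotent group form a
    subgroup (its isolator); in [Ghat * Ghat], the isolator of the image of
    [(phi \o e, chi)] therefore contains the image of [(phi, phi')].  So
    [phi'] kills [T], and separating words by [phi] reduces to separating them
    by the [chi], that is, to the equivalence of [G] and [G^(m^c)]. *)

(** * Subgroups as predicates, generation, and induction on free groups *)

Definition subgroup (G : groupType) (P : G -> Prop) : Prop :=
  [/\ P 1, forall x y, P x -> P y -> P (x * y) & forall x, P x -> P x^-1].

(** Carrying [sP] in the term lets instance inference find the closure properties, so any subgroup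
    predicate can serve as a [groupClosed]. *)
Definition subgroup_pred (G : groupType) (P : G -> Prop) (sP : subgroup P) :
  {pred G} := fun x => `[< P x >].

Lemma subgroup_predE (G : groupType) (P : G -> Prop) (sP : subgroup P) x :
  (x \in subgroup_pred sP) <-> P x.
Proof. by split=> /asboolP. Qed.

Lemma subgroup_pred_mul (G : groupType) (P : G -> Prop) (sP : subgroup P) :
  mulg_closed (subgroup_pred sP).
Proof.
by move=> x y /subgroup_predE Px /subgroup_predE Py; apply/subgroup_predE;
   case: sP => _ + _; apply.
Qed.

Lemma subgroup_pred_one (G : groupType) (P : G -> Prop) (sP : subgroup P) :
  1 \in subgroup_pred sP.
Proof. by apply/subgroup_predE; case: sP. Qed.

Lemma subgroup_pred_inv (G : groupType) (P : G -> Prop) (sP : subgroup P) :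
  invg_closed (subgroup_pred sP).
Proof.
by move=> x /subgroup_predE Px; apply/subgroup_predE; case: sP => _ _; apply.
Qed.

HB.instance Definition _ (G : groupType) (P : G -> Prop) (sP : subgroup P) :=
  isMulClosed.Build G (subgroup_pred sP) (@subgroup_pred_mul G P sP).
HB.instance Definition _ (G : groupType) (P : G -> Prop) (sP : subgroup P) :=
  isMul1Closed.Build G (subgroup_pred sP) (subgroup_pred_one sP).
HB.instance Definition _ (G : groupType) (P : G -> Prop) (sP : subgroup P) :=
  isInvClosed.Build G (subgroup_pred sP) (@subgroup_pred_inv G P sP).

Lemma subgroup_expg (G : groupType) (P : G -> Prop) x n :
  subgroup P -> P x -> P (x ^+ n).
Proof. by case=> P1 PM _ Px; elim: n => // n IH; rewrite expgS; exact: PM. Qed.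

Lemma gen_sub (G : groupType) (A : set G) x : A x -> x \in gen A.
Proof. by move=> Ax; apply/asboolP => S; apply. Qed.

Lemma gen_ind (G : groupType) (A : set G) (P : G -> Prop) :
  subgroup P -> (forall x, A x -> P x) -> forall x, x \in gen A -> P x.
Proof.
move=> sP AP x /asboolP /(_ (subgroup_pred sP)) genx.
by apply/(subgroup_predE sP)/genx => a /AP /(subgroup_predE sP).
Qed.

(** The generators lift to the subgroup cut out by [P]; followed by the inclusion, this lift fixes
    the generators, hence is the identity by uniqueness. *)
Lemma free_ind (X : Type) (F : groupType) (x : X -> F) (P : F -> Prop) :
  free_on x -> subgroup P -> (forall i, P (x i)) -> forall u, P u.
Proof.
move=> Fx sP Px u.
pose S : groupClosed F := subgroup_pred sP.
have Sx i : x i \in S by apply/subgroup_predE.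
have [phi [phix _]] := Fx (subg_of S) (fun i => Subg (Sx i)).
have [theta [_ thetaU]] := Fx F x.
pose psi : hom F F := (\val : subg_of S -> F) \o phi.
have psix : psi \o x =1 x by move=> i /=; have /= -> := phix i.
have idx : (idfun : hom F F) \o x =1 x by [].
have /= -> : u = psi u by rewrite (thetaU _ psix) -(thetaU _ idx).
by apply/(subgroup_predE sP)/valP.
Qed.

(** * Quotients by normal subgroups *)

Record normal_subgroup (G : groupType) := NormalSubgroup {
  normal_set :> G -> Prop;
  normal_subgroupP : subgroup normal_set;
  normal_conj : forall x y, normal_set x -> normal_set (x ^ y) }.

Section Quotient.

Variables (G : groupType) (N : normal_subgroup G).

(** [choose] gives the same value for extensionally equal predicates, so each coset gets one
    representative; the quotient is carried by the fixed points of this map. *)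
Definition coset_repr (x : G) : G := choose (fun y => `[< N (x^-1 * y) >]) x.

Lemma coset_reprP x : N (x^-1 * coset_repr x).
Proof.
apply/asboolP/(@chooseP _ (fun y => `[< N (x^-1 * y) >])).
by apply/asboolP; rewrite mulVg; have [] := normal_subgroupP N.
Qed.

Lemma coset_repr_eq x y : coset_repr x = coset_repr y <-> N (x^-1 * y).
Proof.
have [N1 NM NV] := normal_subgroupP N; split=> [xy|Nxy].
  rewrite (_ : x^-1 * y = x^-1 * coset_repr x * (y^-1 * coset_repr y)^-1).
    by apply: NM; [|apply: NV]; exact: coset_reprP.
  by rewrite xy invgM invgK mulgA mulgK.
rewrite /coset_repr; set P := (X in choose X x); set Q := (X in choose X y).
have eqPQ : P =1 Q.
  move=> z; apply/asboolP/asboolP => Nz.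
    rewrite (_ : y^-1 * z = (x^-1 * y)^-1 * (x^-1 * z)); first exact/NM/Nz/NV.
    by rewrite invgM invgK mulgA mulgK.
  rewrite (_ : x^-1 * z = (x^-1 * y) * (y^-1 * z)); first exact: NM.
  by rewrite mulgA mulgK.
rewrite (eq_choose eqPQ); apply: choose_id; apply/asboolP.
  by rewrite -[y^-1 * x]invgK invgM invgK; apply: NV.
by rewrite mulVg.
Qed.

Lemma coset_repr_id x : coset_repr (coset_repr x) == coset_repr x.
Proof. by apply/eqP/esym/coset_repr_eq/coset_reprP. Qed.

Record quotient : Type :=
  Coset { coset_val : G; coset_valP : coset_repr coset_val == coset_val }.

HB.instance Definition _ := [isSub of quotient for coset_val].
HB.instance Definition _ := [Choice of quotient by <:].

Definition coset (x : G) : quotient := Coset (coset_repr_id x).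

Lemma coset_eq x y : coset x = coset y <-> N (x^-1 * y).
Proof.
rewrite -coset_repr_eq; split=> [/(congr1 coset_val)//|xy]; exact: val_inj.
Qed.

Lemma coset_valK : cancel coset_val coset.
Proof. by move=> q; apply/val_inj/eqP/(valP q). Qed.

Definition coset_mul (p q : quotient) : quotient :=
  coset (coset_val p * coset_val q).
Definition coset_inv (p : quotient) : quotient := coset (coset_val p)^-1.

Lemma coset_mulE x y : coset_mul (coset x) (coset y) = coset (x * y).
Proof.
have [N1 NM NV] := normal_subgroupP N.
apply/esym/coset_eq => /=; set x' := coset_repr x; set y' := coset_repr y.
rewrite (_ : _ * _ = (x^-1 * x') ^ y * (y^-1 * y')).
  by apply: NM; [apply: normal_conj|]; exact: coset_reprP.
by rewrite conjgE invgM !mulgA mulgK.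
Qed.

Lemma coset_invE x : coset_inv (coset x) = coset x^-1.
Proof.
have [N1 NM NV] := normal_subgroupP N.
apply/esym/coset_eq => /=; set x' := coset_repr x.
rewrite (_ : _ * _ = ((x^-1 * x')^-1) ^ x^-1).
  by apply/normal_conj/NV/coset_reprP.
by rewrite conjgE invgM !invgK !mulgA mulgK.
Qed.

Lemma coset_mulA : associative coset_mul.
Proof.
move=> p q r; rewrite -(coset_valK p) -(coset_valK q) -(coset_valK r).
by rewrite !coset_mulE mulgA.
Qed.

Lemma coset_mul1 : left_id (coset 1) coset_mul.
Proof. by move=> p; rewrite -(coset_valK p) coset_mulE mul1g. Qed.

Lemma coset_mulr1 : right_id (coset 1) coset_mul.
Proof. by move=> p; rewrite -(coset_valK p) coset_mulE mulg1. Qed.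

Lemma coset_mulV : left_inverse (coset 1) coset_inv coset_mul.
Proof.
by move=> p; rewrite -(coset_valK p) coset_invE coset_mulE mulVg.
Qed.

Lemma coset_mulrV : right_inverse (coset 1) coset_inv coset_mul.
Proof.
by move=> p; rewrite -(coset_valK p) coset_invE coset_mulE mulgV.
Qed.

HB.instance Definition _ := isGroup.Build quotient
  coset_mulA coset_mul1 coset_mulr1 coset_mulV coset_mulrV.

Lemma coset_morphism : monoid_morphism coset.
Proof. by split=> // x y; rewrite -coset_mulE. Qed.

HB.instance Definition _ :=
  isUMagmaMorphism.Build G quotient coset coset_morphism.

Lemma coset_surj q : exists x, coset x = q.
Proof. by exists (coset_val q); exact: coset_valK. Qed.

Lemma coset_eq1 x : coset x = 1 <-> N x.
Proof.
by rewrite (coset_eq x 1) mulg1; have [_ _ NV] := normal_subgroupP N;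
   split=> /NV; rewrite ?invgK.
Qed.

End Quotient.

(** * Upper central series and commutator identities *)

Fixpoint upper_central (G : groupType) (n : nat) : G -> Prop :=
  if n is k.+1 then fun x => forall y, upper_central k [~ x, y]
  else fun x => x = 1.

Lemma commMg (G : groupType) (x y z : G) :
  [~ x * y, z] = [~ x, z] ^ y * [~ y, z].
Proof.
by rewrite !(commgEl, conjgE) !invgM !mulgA !(mulgK, mulgVK).
Qed.

Lemma commgM (G : groupType) (x y z : G) :
  [~ x, y * z] = [~ x, z] * [~ x, y] ^ z.
Proof.
by rewrite !(commgEl, conjgE) !invgM !mulgA !(mulgK, mulgVK).
Qed.

Lemma commVg (G : groupType) (x y : G) :
  [~ x^-1, y] = [~ x, y]^-1 ^ x^-1.
Proof.
by rewrite !(commgEl, conjgE) !invgM !invgK !mulgA !(mulgK, mulgVK).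
Qed.

Lemma upper_central_conj (G : groupType) n (x y : G) :
  upper_central n x -> upper_central n (x ^ y).
Proof.
elim: n x y => [x y /= ->|n IH x y Zx z]; first by rewrite conj1g.
by rewrite -[z](conjgKV y) -conjRg; apply/IH/Zx.
Qed.

Lemma upper_central_subgroup (G : groupType) n :
  subgroup (@upper_central G n).
Proof.
elim: n => [|n [Z1 ZM ZV]].
  by split=> //= [x y -> ->|x ->]; rewrite ?mulg1 ?invg1.
split=> /= [y|x y Zx Zy z|x Zx z]; first by rewrite comm1g.
  by rewrite commMg; apply: ZM => //; apply/upper_central_conj.
by rewrite commVg; apply/upper_central_conj/ZV.
Qed.

Lemma upper_central_leq (G : groupType) m n (x : G) :
  m <= n -> upper_central m x -> upper_central n x.
Proof.
move=> /subnK <-; elim: (n - m) => //= k IH Zx y.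
have [_ ZM ZV] := @upper_central_subgroup G (k + m).
by rewrite commgEl; apply: ZM; [exact/ZV/IH | exact/upper_central_conj/IH].
Qed.

Definition nilpotency_bound (G : groupType) (c : nat) : Prop :=
  forall x : G, upper_central c x.

(** Term [c - n] of the lower series lies in term [n] of the upper one; [n = c] covers the whole
    group. *)
Lemma nilpotent_group_bound (G : groupType) :
  nilpotent_group G -> exists c, nilpotency_bound G c.
Proof.
case=> c lc1; exists c.
suff lcZ n : n <= c -> forall x : G, x \in lower_central (c - n) ->
    upper_central n x.
  by move=> x; apply: (lcZ c) => //; rewrite subnn.
elim: n => [_ x|n IH nc x lcx y]; first by rewrite subn0; exact: lc1.
apply: IH; first exact: ltnW.
by rewrite -(subnSK nc); apply: gen_sub; exists x, y.
Qed.

(** The offsets record a drop in class: [1, 0] when the centre is killed, [2, 1] when the second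
    centre becomes central. *)
Lemma upper_central_surj (G Q : groupType) (p : hom G Q) a b :
    (forall q, exists x, p x = q) ->
    (forall x, upper_central a x -> upper_central b (p x)) ->
  forall i x, upper_central (i + a) x -> upper_central (i + b) (p x).
Proof.
move=> p_surj pab; elim=> //= i IH x Zx q.
by have [y <-] := p_surj q; rewrite -gmulfR; apply: IH.
Qed.

Lemma upper_central_inj (G H : groupType) (f : hom G H) c x :
  injective f -> upper_central c (f x) -> upper_central c x.
Proof.
move=> f_inj; elim: c x => [x /= fx1|c IH x Zfx y].
  by apply: f_inj; rewrite gmulf1.
by apply: IH; rewrite gmulfR.
Qed.

Lemma nilpotency_bound_pair (G H : groupType) c d :
  nilpotency_bound G c -> nilpotency_bound H d ->
  nilpotency_bound (G * H)%type (maxn c d).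
Proof.
move=> Gc Hd [x y].
have := upper_central_leq (leq_maxl c d) (Gc x).
have := upper_central_leq (leq_maxr c d) (Hd y).
elim: (maxn c d) x y => [x y /= -> -> //|n IH x y Zy Zx [z t]].
by apply: (IH [~ x, z] [~ y, t]).
Qed.

Lemma upper_central1P (G : groupType) (x : G) :
  upper_central 1 x <-> forall y, commute x y.
Proof. by split=> /= Zx y; [apply/commgP/eqP | apply/eqP/commgP]. Qed.

(** Modulo term [j] the commutator [[~ x, y]] is central, so commutation with [y] is multiplicative
    on powers of [x]; [d] collects the errors. *)
Lemma commXg_upper_central (G : groupType) j (x y : G) m :
    upper_central j.+1 [~ x, y] ->
  exists2 d, upper_central j d & [~ x ^+ m, y] = [~ x, y] ^+ m * d.
Proof.
have [Z1 ZM ZV] := @upper_central_subgroup G j.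
move=> Zxy; elim: m => [|m [d Zd dE]]; first by exists 1; rewrite ?comm1g ?mulg1.
set a := [~ x, y] in Zxy dE *.
exists ([~ a, x ^+ m] ^ (a ^+ m) * d).
  by apply: ZM => //; apply: upper_central_conj.
have -> : [~ x ^+ m.+1, y] = a * [~ a, x ^+ m] * (a ^+ m * d).
  by rewrite expgS commMg dE -/a [[~ a, _]]commgEl mulVKg.
move: [~ a, x ^+ m] => b {dE Zxy}; move: a => a.
by rewrite -mulgA (mulgA b) [in LHS](conjgC b) expgS !mulgA.
Qed.

Lemma central_conj (G : groupType) (x y : G) :
  (forall z, commute x z) -> x ^ y = x.
Proof. by move=> /(_ y) xy; apply/conjg_fixP/commgP. Qed.

(** * Transport of subgroups along homomorphisms, and roots in power subgroups *)

Lemma subgroup_hom_preim (G H : groupType) (f : hom G H) (P : H -> Prop) :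
  subgroup P -> subgroup (fun x => P (f x)).
Proof.
case=> P1 PM PV; split=> [|x y Px Py|x Px]; rewrite ?gmulf1 ?gmulfM ?gmulfV //.
  exact: PM.
exact: PV.
Qed.

Lemma subgroup_hom_im (G H : groupType) (f : hom G H) (P : G -> Prop) :
  subgroup P -> subgroup (fun y => exists2 x, P x & f x = y).
Proof.
case=> P1 PM PV; split=> [|_ _ [x Px <-] [y Py <-]|_ [x Px <-]].
- by exists 1; rewrite ?gmulf1.
- by exists (x * y); rewrite ?gmulfM //; apply: PM.
- by exists x^-1; rewrite ?gmulfV //; apply: PV.
Qed.

Lemma groupClosed_subgroup (G : groupType) (S : groupClosed G) :
  subgroup (fun x => x \in S).
Proof.
split; first exact: gpred1.
  by move=> x y Sx Sy; apply: gpredM.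
by move=> x Sx; apply: gpredVr.
Qed.

Lemma subgroup_center (G : groupType) :
  subgroup (fun x : G => forall y, commute x y).
Proof.
split=> [y|x y Zx Zy z|x Zx y].
- by apply: commute_sym; apply: commute1.
- by apply: commute_sym; apply: commuteM; apply: commute_sym.
- by apply: commute_sym; apply: commuteV; apply: commute_sym.
Qed.

Lemma subgroup_central_powers (G : groupType) m :
  subgroup (fun x : G => exists2 z, (forall y, commute z y) & z ^+ m = x).
Proof.
have [Z1 ZM ZV] := subgroup_center G.
split=> [|_ _ [x Zx <-] [y Zy <-]|_ [x Zx <-]].
- by exists 1; rewrite ?expg1n.
- by exists (x * y); rewrite ?expgMn //; apply: ZM.
- by exists x^-1; rewrite ?expVgn //; apply: ZV.
Qed.

Lemma central_powers_conj (G : groupType) m (x y : G) :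
  (exists2 z, (forall y, commute z y) & z ^+ m = x) ->
  (exists2 z, (forall y, commute z y) & z ^+ m = x ^ y).
Proof. by case=> z Zz <-; exists z; rewrite // conjXg central_conj. Qed.

(* Modulo the m-th powers of central elements, m-th powers generate a subgroup
   of smaller class, and a central m-th power can be absorbed into an m-th
   power. *)
Lemma power_subgroup_roots m c (G : groupType) : nilpotency_bound G c ->
  forall x : G, x \in power_subgroup G (m ^ c) -> exists y, y ^+ m = x.
Proof.
elim: c G => [|c IH] G Gc x xGm; first by exists 1; rewrite expg1n (Gc x : x = 1).
pose N := NormalSubgroup (subgroup_central_powers G m)
                         (@central_powers_conj G m).
pose Q : groupType := quotient N; pose p : hom G Q := @coset G N.
have p_surj q : exists x, p x = q by exact: coset_surj.
(* In [Q] the [m]-th powers of images of central elements vanish; the commutator formula carries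
   this up the series, so [m]-th powers drop one level. *)
have pZ j (u : G) : upper_central j.+1 u -> upper_central j (p u ^+ m).
  elim: j u => [u Zu|j IHj u Zu q] /=.
    rewrite -gmulfXn; apply/coset_eq1; exists u => //; exact/upper_central1P.
  have [y <-] := p_surj q.
  have [d Zd] := commXg_upper_central m (Zu y).
  rewrite -gmulfXn -gmulfR => ->; rewrite gmulfM gmulfXn.
  have [_ ZM _] := @upper_central_subgroup Q j.
  apply: ZM; first exact/IHj/Zu.
  have := @upper_central_surj _ _ p 0 0 p_surj _ j d.
  rewrite !addn0; apply=> // _ ->; exact: gmulf1.
pose R : groupType := subg_of (power_subgroup Q m).
have Rc : nilpotency_bound R c.
  move=> r; apply: (@upper_central_inj _ _ (\val : R -> Q)); first exact: val_inj.
  apply: (gen_ind (@upper_central_subgroup Q c) _ (valP r)).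
  by move=> _ [q _ <-]; have [u <-] := p_surj q; apply/pZ/Gc.
(* The image of [g ^+ (m ^ c.+1)] is the [m ^ c]-th power of [p g ^+ m], which lies in [R]. *)
have [r rRm rx] : exists2 r : R, r \in power_subgroup R (m ^ c) & val r = p x.
  pose P q := exists2 r : R, r \in power_subgroup R (m ^ c) & val r = q.
  apply: (gen_ind (P := fun x => P (p x)) _ _ xGm).
    exact/(subgroup_hom_preim p)/(subgroup_hom_im (\val : R -> Q))
         /groupClosed_subgroup.
  move=> _ [g _ <-].
  have gm : p g ^+ m \in power_subgroup Q m by apply: gen_sub; exists (p g).
  exists (Subg gm ^+ (m ^ c)); first by apply: gen_sub; exists (Subg gm).
  by rewrite !gmulfXn -expgnA -expnS.
have [t tr] := IH R Rc r rRm.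
have [u ut] := p_surj (val t).
have : N ((u ^+ m)^-1 * x).
  by apply/coset_eq; rewrite gmulfXn -/p ut -rx -tr gmulfXn.
case=> z Zz zE; exists (u * z); rewrite expgMn ?zE ?mulVKg //.
by apply: commute_sym.
Qed.

(** * Isolators in nilpotent groups *)

Definition isolator (pi : nat_pred) (G : groupType) (H : G -> Prop) (x : G) :=
  exists2 n, pi.-nat n & H (x ^+ n).

Lemma sub_isolator (pi : nat_pred) (G : groupType) (H : G -> Prop) x :
  H x -> isolator pi H x.
Proof. by exists 1%N. Qed.

Lemma isolatorM (pi : nat_pred) (G : groupType) (H : G -> Prop) x y :
  subgroup H -> commute x y -> isolator pi H x -> isolator pi H y ->
  isolator pi H (x * y).
Proof.
move=> sH xy [m pim Hx] [n pin Hy]; exists (m * n)%N; first by rewrite pnatM pim.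
rewrite expgMn // {2}mulnC !expgnA; have [_ HM _] := sH.
by apply: HM; apply: subgroup_expg.
Qed.

Lemma isolatorV (pi : nat_pred) (G : groupType) (H : G -> Prop) x :
  subgroup H -> isolator pi H x -> isolator pi H x^-1.
Proof. by case=> _ _ HV [n pin Hx]; exists n; rewrite // expVgn; apply: HV. Qed.

Lemma isolator1 (pi : nat_pred) (G : groupType) (H : G -> Prop) :
  subgroup H -> isolator pi H 1.
Proof. by case=> H1 _ _; apply: sub_isolator. Qed.

Definition subgroup_generated (G : groupType) (A : G -> Prop) : Prop :=
  forall P : G -> Prop, subgroup P -> (forall x, A x -> P x) -> forall x, P x.

Lemma subgroup_central_isolator (pi : nat_pred) (G : groupType)
    (H : G -> Prop) : subgroup H ->
  subgroup (fun x => (forall y, commute x y) /\ isolator pi H x).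
Proof.
move=> sH; have [Z1 ZM ZV] := subgroup_center G.
split=> [|x y [Zx Ix] [Zy Iy]|x [Zx Ix]].
- by split; [exact: Z1 | exact: isolator1].
- by split; [exact: ZM | exact: isolatorM].
- by split; [exact: ZV | exact: isolatorV].
Qed.

Lemma central_isolator_conj (pi : nat_pred) (G : groupType) (H : G -> Prop)
    (x y : G) :
  (forall z, commute x z) /\ isolator pi H x ->
  (forall z, commute (x ^ y) z) /\ isolator pi H (x ^ y).
Proof. by case=> Zx Ix; rewrite central_conj. Qed.

Lemma center_conj (G : groupType) (x y : G) :
  (forall z, commute x z) -> forall z, commute (x ^ y) z.
Proof. by move=> Zx; rewrite central_conj. Qed.

Lemma subgroup_generated_im (pi : nat_pred) (G Q : groupType) (p : hom G Q)
    (H : G -> Prop) :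
    (forall q, exists x, p x = q) -> subgroup_generated (isolator pi H) ->
  subgroup_generated (isolator pi (fun q => exists2 x, H x & p x = q)).
Proof.
move=> p_surj genH P sP IP q; have [x <-] := p_surj q.
apply: (genH (fun x => P (p x))); first exact: subgroup_hom_preim.
move=> y [n pin Hy]; apply: IP; exists n => //.
by exists (y ^+ n); rewrite ?gmulfXn.
Qed.

Lemma commXXg_central (G : groupType) (x y : G) m n :
  (forall z, commute [~ x, y] z) -> [~ x ^+ m, y ^+ n] = [~ x, y] ^+ (m * n)%N.
Proof.
move=> Zxy.
have xmy k : [~ x ^+ k, y] = [~ x, y] ^+ k.
  elim: k => [|k IH]; first by rewrite comm1g.
  by rewrite !expgS commMg IH central_conj.
have Zk k z : commute [~ x ^+ k, y] z.
  by rewrite xmy; apply: commute_sym; apply: commuteX; apply: commute_sym.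
have Zkn k j z : commute [~ x ^+ k, y ^+ j] z.
  elim: j z => [|j IH] z; first by rewrite commg1; apply/commute_sym/commute1.
  rewrite (expgSr y) commgM central_conj //.
  by apply: commute_sym; apply: commuteM; apply: commute_sym.
rewrite expgnA -xmy; elim: n => [|n IH]; first by rewrite commg1.
by rewrite (expgSr y) commgM IH central_conj ?expgS // -IH => z; apply: Zkn.
Qed.

(** Since [[~ u, g]] is central and multiplicative in [g], it suffices to treat [g = s] with
    [s ^+ k] in [H]; then [[~ u, s] ^+ (n * k)] equals [[~ h, s ^+ k]], as [z] is central. *)
Lemma isolator_commg (pi : nat_pred) (G : groupType) (H : G -> Prop)
    (u : G) :
    subgroup H -> subgroup_generated (isolator pi H) ->
    (forall g z, commute [~ u, g] z) ->
    (exists n h z, [/\ pi.-nat n, H h, (forall g, commute z g)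
                     & u ^+ n = h * z]) ->
  forall g, isolator pi H [~ u, g].
Proof.
move=> sH genH Zu [n [h [z [pin Hh Zz unE]]]].
apply: genH.
  split=> [|x y Ix Iy|x Ix].
  - by rewrite commg1; apply: isolator1.
  - by rewrite commgM central_conj //; apply: isolatorM.
  - rewrite (_ : [~ u, x^-1] = [~ u, x]^-1); first exact: isolatorV.
    have := commgM u x x^-1; rewrite mulgV commg1 central_conj // => uxV.
    by apply: (mulIg [~ u, x]); rewrite mulVg.
move=> s [k pik Hs]; exists (n * k)%N; first by rewrite pnatM pin.
rewrite -commXXg_central // unE commMg.
have /eqP -> : [~ z, s ^+ k] == 1 by apply/commgP.
have -> : [~ h, s ^+ k] ^ z = [~ h, s ^+ k].
  by apply/conjg_fixP/commgP; apply: commute_sym.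
have [_ HM HV] := sH; rewrite mulg1 commgEl conjgE.
by apply: (HM _ _ (HV _ Hh)); apply: (HM _ _ (HV _ Hs)); apply: HM.
Qed.

(* Induction on the class.  Modulo the centre, every [u] has a pi-power in [H];
   if [u] lies in the second centre, [[u, g]] is central and multiplicative in
   [g], so it has a pi-power in [H].  Hence the central elements of the
   isolator can be factored out, and this lowers the class. *)
Lemma isolator_full (pi : nat_pred) c (G : groupType) (H : G -> Prop) :
    nilpotency_bound G c.+1 -> subgroup H ->
    subgroup_generated (isolator pi H) ->
  forall x, isolator pi H x.
Proof.
elim: c G H => [|c IH] G H Gc sH genH x.
  (* In class at most one all elements commute, so the isolator is already a subgroup. *)
  apply: genH => //; split=> [|y z|y]; first exact: isolator1.
    by apply: isolatorM => //; have /upper_central1P := Gc y; apply.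
  exact: isolatorV.
(* The induction hypothesis for the image of [H] modulo [N], pulled back to [G]. It is used first
   with the centre, then with its isolated part. *)
have modZ (N : normal_subgroup G) :
    nilpotency_bound (quotient N) c.+1 ->
    forall u, exists n h z, [/\ pi.-nat n, H h, N z & u ^+ n = h * z].
  move=> Nc u; pose p : hom G (quotient N) := @coset G N.
  have p_surj q : exists x, p x = q by exact: coset_surj.
  have [n pin [h Hh hE]] := IH _ _ Nc (subgroup_hom_im p sH)
    (subgroup_generated_im p_surj genH) (p u).
  exists n, h, (h^-1 * u ^+ n); split; rewrite ?mulVKg //.
  by apply/coset_eq; rewrite -/p hE gmulfXn.
pose Z := NormalSubgroup (subgroup_center G) (@center_conj G).
have Zc : nilpotency_bound (quotient Z) c.+1.
  move=> q; have [u <-] := coset_surj q; have := Gc u.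
  rewrite -[c.+2]addn1 -{2}[c.+1]addn0.
  apply: (@upper_central_surj _ _ (@coset G Z)); first exact: coset_surj.
  by move=> v /upper_central1P Zv; apply/coset_eq1.
pose N := NormalSubgroup (subgroup_central_isolator pi sH)
                         (@central_isolator_conj pi G H).
have Nc : nilpotency_bound (quotient N) c.+1.
  move=> q; have [u <-] := coset_surj q; have := Gc u.
  rewrite -[c.+2]addn2 -[c.+1]addn1.
  apply: (@upper_central_surj _ _ (@coset G N)); first exact: coset_surj.
  move=> v Zv r; have [g <-] := coset_surj r.
  have Zvg w z : commute [~ v, w] z by have /upper_central1P := Zv w; apply.
  rewrite -(gmulfR (@coset G N)); apply/coset_eq1; split=> //.
  exact: isolator_commg (modZ Z Zc v) g.
have [n [h [z [pin Hh [Zz Iz] xE]]]] := modZ N Nc x.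
have [k pik] : isolator pi H (x ^+ n).
  rewrite xE; apply: isolatorM => //; first by apply: commute_sym.
  exact: sub_isolator.
by exists (n * k)%N; rewrite ?pnatM ?pin // expgnA.
Qed.

(** Inside the subgroup [S] generated by the isolator, [isolator_full] applies and shows that the
    isolator is all of [S]. *)
Lemma isolator_subgroup (pi : nat_pred) (G : groupType) (H : G -> Prop) :
  (exists c, nilpotency_bound G c) -> subgroup H -> subgroup (isolator pi H).
Proof.
move=> [c Gc] sH.
pose S : groupClosed G := gen (isolator pi H).
have sHS := subgroup_hom_preim (\val : subg_of S -> G) sH.
have Sc : nilpotency_bound (subg_of S) c.+1.
  move=> r; apply: (upper_central_leq (leqnSn c)).
  exact: (@upper_central_inj _ _ (\val : subg_of S -> G)) val_inj (Gc _).
have genS : subgroup_generated (isolator pi (fun r : subg_of S => H (val r))).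
  move=> P sP IP r.
  have [q [Pq qr]] : exists q, P q /\ val q = val r.
    pose Q x := exists2 q : subg_of S, P q & val q = x.
    suff [q Pq qr] : Q (val r) by exists q.
    apply: (gen_ind (A := isolator pi H) _ _ (valP r)).
      exact: (subgroup_hom_im (\val : subg_of S -> G)).
    move=> x Ix; have Sx : x \in S by apply: gen_sub.
    exists (Subg Sx) => //; apply: IP; case: Ix => n pin Hx.
    by exists n; rewrite ?gmulfXn.
  by rewrite -(val_inj qr).
have IS x : x \in S -> isolator pi H x.
  move=> Sx; have [n pin] := isolator_full Sc sHS genS (Subg Sx).
  by rewrite gmulfXn; exists n.
have [S1 SM SV] := groupClosed_subgroup S.
split=> [|x y Ix Iy|x Ix]; apply: IS => //.
  by apply: SM; apply: gen_sub.
by apply: SV; apply: gen_sub.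
Qed.

(** * The completion as an isolator, and homomorphisms from free groups *)

Lemma subgroup_range (G H : groupType) (f : hom G H) :
  subgroup (fun y => exists x, f x = y).
Proof.
split=> [|_ _ [x <-] [y <-]|_ [x <-]]; first by exists 1; rewrite gmulf1.
  by exists (x * y); rewrite gmulfM.
by exists x^-1; rewrite gmulfV.
Qed.

Section PairHom.

Variables (F G H : groupType) (f : hom F G) (g : hom F H).

Definition pair_hom (u : F) : G * H := (f u, g u).

Lemma pair_hom_morphism : monoid_morphism pair_hom.
Proof. by split=> [|u v]; rewrite /pair_hom ?gmulf1 ?gmulfM. Qed.

HB.instance Definition _ :=
  isUMagmaMorphism.Build F (G * H)%type pair_hom pair_hom_morphism.

End PairHom.

(** The isolator of the image contains all pi-roots of its elements, so it is pi-complete and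
    minimality applies. *)
Lemma pi_completion_isolator (pi : nat_pred) (G Ghat : groupType)
    (iota : hom G Ghat) : is_pi_completion pi iota ->
  forall x, isolator pi (fun y => exists g, iota g = y) x.
Proof.
case=> _ /nilpotent_group_bound nilp [div tf] minimal x.
have sI := isolator_subgroup pi nilp (subgroup_range iota).
apply/(subgroup_predE sI)/minimal => [g|].
  by apply/(subgroup_predE sI)/sub_isolator; exists g.
split=> [n pin a|n pin a an1]; last first.
  apply/val_inj/(tf n pin).
  by rewrite -(gmulfXn (\val : subg_of (subgroup_pred sI) -> Ghat)) an1 gmulf1.
have [y ya] := div n pin (val a).
have Sy : y \in subgroup_pred sI.
  have /(subgroup_predE sI) [k pik] := valP a; rewrite -ya -expgnA => Hy.
  by apply/(subgroup_predE sI); exists (n * k)%N; rewrite ?pnatM ?pin.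
by exists (Subg Sy); apply: val_inj; rewrite gmulfXn.
Qed.

Lemma free_hom_eq (X : Type) (F H : groupType) (x : X -> F)
    (phi psi : hom F H) :
  free_on x -> (forall i, phi (x i) = psi (x i)) -> phi =1 psi.
Proof.
move=> Fx eqx; have [theta [_ thetaU]] := Fx H (phi \o x).
by move=> u; rewrite (thetaU phi) // (thetaU psi) // => i /=.
Qed.

Lemma free_hom_lift (X : Type) (F H : groupType) (x : X -> F) (f : X -> H) :
  free_on x -> exists phi : hom F H, forall i, phi (x i) = f i.
Proof. by move=> Fx; have [phi [phix _]] := Fx H f; exists phi. Qed.

Lemma gclosure_inj (F G H : groupType) (f : hom G H) (T : set F) :
  injective f -> (gclosure H T `<=` gclosure G T)%classic.
Proof.
move=> f_inj u clu phi phiT; apply: f_inj; rewrite gmulf1.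
apply: (clu (f \o phi)) => t Tt.
by rewrite /Ker /= (phiT t Tt : phi t = 1) gmulf1.
Qed.

(** * From equivalence with the completion to equivalence with power subgroups *)

Lemma geom_equiv_power_subgroup (pi : nat_pred) (G Ghat : groupType)
    (iota : hom G Ghat) m :
    is_pi_completion pi iota -> geom_equiv G Ghat -> pi.-nat m ->
  geom_equiv G (subg_of (power_subgroup G m)).
Proof.
move=> [iota_inj _ [div _] _] equiv pim X F x Fx T.
pose Gm : groupType := subg_of (power_subgroup G m).
apply/classical_sets.seteqP; split.
  by apply: (@gclosure_inj _ _ _ (\val : Gm -> G)); exact: val_inj.
move=> u clu phi phiT.
have [y yE] := choice (fun i => div m pim (iota (phi (x i)))).
have [theta thetaE] := free_hom_lift y Fx.
have [e eE] := free_hom_lift (fun i => x i ^+ m) Fx.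
have thetae v : theta (e v) = iota (phi v).
  apply: (free_hom_eq (phi := theta \o e) (psi := iota \o phi) Fx) => i /=.
  by rewrite eE gmulfXn thetaE yE.
apply: iota_inj; rewrite gmulf1 -thetae.
(* The system solved is [Ker theta]: evaluating at [theta] itself gives the goal, while [e] sends
   [T] into this kernel. *)
have : gclosure Ghat (Ker theta) (e u).
  rewrite -(equiv _ _ _ Fx) => chi chiT.
  have chim i : chi (x i) ^+ m \in power_subgroup G m.
    by apply: gen_sub; exists (chi (x i)).
  have [psi psiE] := free_hom_lift (fun i => Subg (chim i) : Gm) Fx.
  have psie v : val (psi v) = chi (e v).
    apply: (free_hom_eq (phi := (\val : Gm -> G) \o psi) (psi := chi \o e) Fx).
    by move=> i /=; rewrite psiE eE gmulfXn.
  rewrite /Ker /= -psie (_ : psi u = 1) ?gmulf1 //.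
  apply: clu => t Tt; apply: val_inj; rewrite psie gmulf1.
  apply: chiT; rewrite /Ker /= thetae (phiT t Tt : phi t = 1); exact: gmulf1.
by apply.
Qed.

(** * From equivalence with power subgroups to equivalence with the completion *)

(** The product of the individual exponents works, by finiteness of [X]. *)
Lemma common_pi_exponent (pi : nat_pred) (X : finType) (G : groupType)
    (P : G -> Prop) (a : X -> G) :
    subgroup P -> (forall i, isolator pi P (a i)) ->
  exists2 m, pi.-nat m & forall i, P (a i ^+ m).
Proof.
move=> sP Ia.
have {}Ia i : exists k, pi.-nat k /\ P (a i ^+ k) by have [k] := Ia i; exists k.
have [n nP] := choice Ia.
exists (\prod_i n i)%N => [|i].
  by apply: (big_ind (fun k => pi.-nat k)) => // [k l pik pil|i _];
     [rewrite pnatM pik | have [] := nP i].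
by rewrite (bigD1 i) //= expgnA; apply: subgroup_expg => //; have [] := nP i.
Qed.

Lemma power_subgroup_geom_equiv (pi : nat_pred) (G Ghat : groupType)
    (iota : hom G Ghat) :
    nilpotent_group G -> pi_torsion_free pi G -> is_pi_completion pi iota ->
    (forall m, pi.-nat m -> geom_equiv G (subg_of (power_subgroup G m))) ->
  geom_equiv G Ghat.
Proof.
move=> /nilpotent_group_bound [c Gc] tfG comp equiv X F x Fx T.
have Iiota := pi_completion_isolator comp.
have [iota_inj /nilpotent_group_bound nilp [_ tf] _] := comp.
apply/classical_sets.seteqP; split; last exact: gclosure_inj iota_inj.
move=> u clu phi phiT.
have [m pim phim] := common_pi_exponent (subgroup_range iota)
   (fun i => Iiota (phi (x i))).
have [a aE] := choice phim.
have [e eE] := free_hom_lift (fun i => x i ^+ m) Fx.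
have [alpha alphaE] := free_hom_lift a Fx.
have phie v : phi (e v) = iota (alpha v).
  apply: (free_hom_eq (phi := phi \o e) (psi := iota \o alpha) Fx) => i /=.
  by rewrite eE alphaE gmulfXn aE.
have [N piN [k kE]] :
    isolator pi (fun y => exists k, phi (e k) = y) (phi u).
  pose P y := isolator pi (fun y => exists k, phi (e k) = y) y.
  apply: (free_ind (P := fun v => P (phi v)) Fx) => [|i].
    apply: subgroup_hom_preim; apply: isolator_subgroup => //.
    exact: (subgroup_range (phi \o e)).
  by exists m => //; exists (x i); rewrite eE gmulfXn.
apply: (tf N piN); rewrite -kE phie; suff -> : alpha k = 1 by exact: gmulf1.
have piM : pi.-nat (m ^ c)%N by rewrite pnatX pim.
(* [alpha] solves its own kernel, so membership of [k] in the closure yields [alpha k = 1]. *)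
have : gclosure G (Ker alpha) k; last by apply.
rewrite (equiv _ piM _ _ _ Fx) => chi chiT.
have [b bE] := choice (fun i => power_subgroup_roots Gc (valP (chi (x i)))).
have [phi' phi'E] := free_hom_lift b Fx.
pose jota : hom (subg_of (power_subgroup G (m ^ c))) G := \val.
(* As [chi] kills [Ker alpha], it factors through [phi \o e]. *)
have chi_fun v w : phi (e v) = phi (e w) -> chi v = chi w.
  rewrite !phie => /iota_inj vw; apply: divg1_eq; rewrite -gmulfF.
  by apply: chiT; rewrite /Ker /= gmulfF vw mulgV.
pose gamma : hom F (Ghat * Ghat)%type :=
  pair_hom (phi \o e) (iota \o (jota \o chi)).
pose delta : hom F (Ghat * Ghat)%type := pair_hom phi (iota \o phi').
have Igamma v : isolator pi (fun z => exists w, gamma w = z) (delta v).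
  move: v; apply: (free_ind Fx) => [|i].
    apply: (subgroup_hom_preim delta); apply: isolator_subgroup.
      by have [d Gd] := nilp; exists (maxn d d); apply: nilpotency_bound_pair.
    exact: subgroup_range.
  exists m => //; exists (x i).
  by rewrite -gmulfXn /= /pair_hom /= eE (gmulfXn phi') phi'E bE.
(* Working in the product gives one [n] and one [w] for both coordinates. *)
have chi_power v : exists n w, [/\ pi.-nat n, phi (e w) = phi v ^+ n
                                 & jota (chi w) = phi' v ^+ n].
  have [n pin [w]] := Igamma v.
  rewrite -gmulfXn => -[/= phiw /iota_inj phi'w]; exists n, w.
  by rewrite -!gmulfXn.
(* For [t] in [T], [phi t = 1] forces [chi w = 1], so a pi-power of [phi' t] is trivial; thus [phi']
   solves [T]. *)
have phi'u : phi' u = 1.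
  apply: clu => t Tt; have [n [w [pin phiw chiw]]] := chi_power t.
  apply: (tfG n pin); rewrite -chiw (chi_fun w 1).
    by rewrite !gmulf1.
  by rewrite phiw (phiT t Tt : phi t = 1) expg1n !gmulf1.
have [n [w [pin phiw chiw]]] := chi_power u.
apply/val_inj/(tfG n pin); rewrite -[LHS](gmulfXn jota) -gmulfXn.
(* [k ^+ n] and [w ^+ N] have the same image under [phi \o e], namely [phi u] to the power
   [N * n]. *)
rewrite (chi_fun _ (w ^+ N)).
  by rewrite !gmulfXn chiw phi'u !expg1n.
by rewrite !gmulfXn kE phiw -!expgnA mulnC.
Qed.

Theorem theorem3p5 (pi : nat_pred)
    (pi_primes : forall p : nat, p \in pi -> prime p)
    (pi_nonempty : exists p : nat, p \in pi)
    (G : groupType) (G_nilpotent : nilpotent_group G)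
    (G_torsion_free : pi_torsion_free pi G)
    (Ghat : groupType) (iota : hom G Ghat)
    (Ghat_completion : is_pi_completion pi iota) :
  geom_equiv G Ghat <->
  (forall m : nat, pi.-nat m -> geom_equiv G (subg_of (power_subgroup G m))).
Proof.
split=> [equiv m|equiv].
  exact: geom_equiv_power_subgroup Ghat_completion equiv.
exact: power_subgroup_geom_equiv G_nilpotent G_torsion_free Ghat_completion _.
Qed.
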